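(* Let $I$ be any totally ordered set. Let $\{(G_i,\|\cdot\|_i,p_i)\}_{i\in I}$ be a collection of groups together with integer valued norms $\|\cdot\|_i$ and maps $p_i:G_i\to G_i$. Denote the induced metrics by $d_i(g,h)=\|gh^{-1}\|_i$ and assume that for all $i\in I$ (i) $d_i(p_i(g),p_i(h))\le d_i(g,h)$ for all $g,h\in G_i$; (ii) $d_i(p_i(g),g)\le1$ for all $g\in G_i$; (iii) $\|p_i(g)\|_i<\|g\|_i$ for all non-trivial $g\in G_i$; (iv) $p_i(1)=1$, where $1\in G_i$ is the trivial element. Then all asymptotic cones of $G=\bigoplus_{i\in I}G_i$ with respect to the $\ell_1$-norm $\|(g_i)_i\|=\sum_i\|g_i\|_i$ are contractible (for every non-principal ultrafilter on $\mathbb{N}$ and every scaling sequence).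
   Context: A norm on a group $G$ is $\|\cdot\|:G\to[0,\infty)$ with $\|g\|=0$ iff $g=1$, $\|gh\|\le\|g\|+\|h\|$ and $\|g^{-1}\|=\|g\|$ (so that $d(g,h)=\|gh^{-1}\|$ is a metric). Given a non-principal ultrafilter $\omega$ on $\mathbb{N}$ and a scaling sequence, i.e. positive reals $(s_n)$ with $\lim_\omega s_n=\infty$, a sequence $(x_n)$ in $G$ is admissible if $\|x_n\|/s_n$ is bounded; the asymptotic cone $\mathrm{Cone}_\omega(G,s_n)$ is the metric space of admissible sequences modulo $\lim_\omega d(x_n,y_n)/s_n=0$, with metric $\lim_\omega d(x_n,y_n)/s_n$. *)

(* Defs.v *)
From HB Require Import structures.
From mathcomp Require Import all_boot all_order all_algebra.
From mathcomp Require Import all_classical all_reals all_analysis.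

Set Implicit Arguments.
Unset Strict Implicit.
Unset Printing Implicit Defensive.

Import Order.TTheory GRing.Theory Num.Theory.
Import numFieldNormedType.Exports.

Local Open Scope classical_set_scope.
Local Open Scope ring_scope.
Local Open Scope quotient_scope.

Record group_norm (R : realType) (G : groupType) := GroupNorm {
  gnorm :> G -> R ;
  gnorm_ge0 : forall g, 0 <= gnorm g ;
  gnorm_eq0 : forall g, gnorm g = 0 <-> g = 1%g ;
  gnormM : forall g h, gnorm (g * h)%g <= gnorm g + gnorm h ;
  gnormV : forall g, gnorm g^-1%g = gnorm g }.

Definition gdist (R : realType) (G : groupType) (N : group_norm R G) (g h : G)
  : R := N (g * h^-1)%g.

Section gdist_theory.
Context (R : realType) (G : groupType) (N : group_norm R G).

Lemma gnorm1 : N 1%g = 0. Proof. exact/gnorm_eq0. Qed.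

Lemma gdist_ge0 g h : 0 <= gdist N g h.
Proof. exact: gnorm_ge0. Qed.

Lemma gdistxx g : gdist N g g = 0.
Proof. by rewrite /gdist mulgV gnorm1. Qed.

Lemma gdistC g h : gdist N g h = gdist N h g.
Proof. by rewrite /gdist -gnormV invgM invgK. Qed.

Lemma gdist_triangle h g k : gdist N g k <= gdist N g h + gdist N h k.
Proof.
rewrite /gdist (_ : g * k^-1 = (g * h^-1) * (h * k^-1))%g; first exact: gnormM.
by rewrite -mulgA mulKg.
Qed.

Lemma gdist_le g h : gdist N g h <= N g + N h.
Proof. by rewrite /gdist -(gnormV N h) gnormM. Qed.

End gdist_theory.

Record dsum (I : choiceType) (G : I -> groupType) := DSum {
  dsum_val :> forall i, G i ;
  dsum_finite : finite_set [set i | dsum_val i != 1%g] }.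

Section dsum_group.
Context (I : choiceType) (G : I -> groupType).
Implicit Types x y z : dsum G.

Lemma dsum_ext x y : (forall i, x i = y i) -> x = y.
Proof.
case: x y => [x fx] [y fy] /= xy.
have e : x = y by apply/functional_extensionality_dep.
by subst y; congr DSum; exact: Prop_irrelevance.
Qed.

HB.instance Definition _ := gen_eqMixin (dsum G).
HB.instance Definition _ := gen_choiceMixin (dsum G).

Lemma dsum1_finite : finite_set [set i | (1%g : G i) != 1%g].
Proof. by rewrite [X in finite_set X](_ : _ = set0)// -subset0 => i /= /eqP. Qed.

Lemma dsumV_finite x : finite_set [set i | (x i)^-1%g != 1%g].
Proof.
apply: sub_finite_set (dsum_finite x) => i /=.
by apply: contra_neq => ->; rewrite invg1.
Qed.

Lemma dsumM_finite x y : finite_set [set i | (x i * y i)%g != 1%g].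
Proof.
apply: (@sub_finite_set _ _ ([set i | x i != 1%g] `|` [set i | y i != 1%g])).
  move=> i /= xy; have [xi|] := eqVneq (x i) 1%g; last by left.
  by right; move: xy; rewrite xi mul1g.
by rewrite finite_setU; split; exact: dsum_finite.
Qed.

Definition dsum1 : dsum G := DSum dsum1_finite.
Definition dsumV x : dsum G := DSum (dsumV_finite x).
Definition dsumM x y : dsum G := DSum (dsumM_finite x y).

Fact dsum_mulA : associative dsumM.
Proof. by move=> x y z; apply: dsum_ext => i /=; rewrite mulgA. Qed.
Fact dsum_mul1g : left_id dsum1 dsumM.
Proof. by move=> x; apply: dsum_ext => i /=; rewrite mul1g. Qed.
Fact dsum_mulg1 : right_id dsum1 dsumM.
Proof. by move=> x; apply: dsum_ext => i /=; rewrite mulg1. Qed.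
Fact dsum_mulVg : left_inverse dsum1 dsumV dsumM.
Proof. by move=> x; apply: dsum_ext => i /=; rewrite mulVg. Qed.
Fact dsum_mulgV : right_inverse dsum1 dsumV dsumM.
Proof. by move=> x; apply: dsum_ext => i /=; rewrite mulgV. Qed.

HB.instance Definition _ := isGroup.Build (dsum G)
  dsum_mulA dsum_mul1g dsum_mulg1 dsum_mulVg dsum_mulgV.

End dsum_group.

Section l1_norm.
Context (R : realType) (I : choiceType) (G : I -> groupType).
Context (N : forall i, group_norm R (G i)).
Implicit Types x y : dsum G.

(* This finitely supported sum would be 0 on an infinite support, a case
   excluded by dsum_finite since norms vanish at 1. *)
Definition l1 x : R := \sum_(i \in [set: I]) N i (x i).

Lemma l1E (A : set I) x : finite_set A -> [set i | x i != 1%g] `<=` A ->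
  l1 x = \sum_(i \in A) N i (x i).
Proof.
move=> Af sA; apply/esym/fsbig_widen => // i [_ nAi] /=.
have [->|xi] := eqVneq (x i) 1%g; first exact: gnorm1.
by case: nAi; exact: sA.
Qed.

Fact l1_ge0 x : 0 <= l1 x.
Proof. by apply: fsumr_ge0 => i _; exact: gnorm_ge0. Qed.

Fact l1_eq0 x : l1 x = 0 <-> x = 1%g.
Proof.
split=> [|->]; last by apply: fsbig1 => i _; exact: gnorm1.
rewrite (l1E (dsum_finite x))//.
move=> /(pfsumr_eq0 (dsum_finite x)) => h.
apply: dsum_ext => i /=; have [//|xi] := eqVneq (x i) 1%g.
by apply/(gnorm_eq0 (N i))/h => // j _; exact: gnorm_ge0.
Qed.

Fact l1M x y : l1 (x * y)%g <= l1 x + l1 y.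
Proof.
have Uf : finite_set ([set i | x i != 1%g] `|` [set i | y i != 1%g]).
  by rewrite finite_setU; split; exact: dsum_finite.
rewrite (l1E Uf (x := (x * y)%g)); last first.
  move=> i /= xy; have [xi|] := eqVneq (x i) 1%g; last by left.
  by right; move: xy; rewrite xi mul1g.
rewrite (l1E Uf (x := x)); last by move=> i; left.
rewrite (l1E Uf (x := y)); last by move=> i; right.
rewrite -fsbig_split//= !fsbig_finite//=.
by apply: ler_sum => i _; exact: gnormM.
Qed.

Fact l1V x : l1 x^-1%g = l1 x.
Proof. by apply: eq_fsbigr => i _; rewrite gnormV. Qed.

Definition l1_norm : group_norm R (dsum G) := GroupNorm l1_ge0 l1_eq0 l1M l1V.

End l1_norm.

Lemma ultra_cvg_bounded (R : realType) (T : Type) (U : set_system T)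
    (UU : UltraFilter U) (u : T -> R) (a b : R) :
  (forall t, a <= u t <= b) -> cvg (u @ U).
Proof.
move=> uab; pose F := u @ U.
have PF : ProperFilter F by exact: fmap_proper_filter.
have [p [_ Fp]] : `[a, b]%classic `&` cluster F !=set0.
  apply: (@segment_compact R a b F PF); rewrite /F /fmap/=.
  apply: filterE => t /=.
  by rewrite in_itv/= uab.
apply/cvg_ex; exists p => V Vp.
have [//|nV] := @in_ultra_setVsetC _ U (u @^-1` V) UU.
have [z [/= + ?]] := Fp (~` V) V nV Vp.
by [].
Qed.

Record admissible (R : realType) (G : groupType) (N : group_norm R G)
    (s : nat -> R) := Admissible {
  adm_seq :> nat -> G ;
  adm_bounded : exists C : R, forall n, N (adm_seq n) / s n <= C }.

Section asymptotic_cone.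
Context (R : realType) (G : groupType) (N : group_norm R G).
Context (U : set_system nat) (UU : UltraFilter U).
Context (s : nat -> R) (s_gt0 : forall n, 0 < s n).

Local Notation adm := (admissible N s).
Implicit Types x y z : adm.

HB.instance Definition _ := gen_eqMixin adm.
HB.instance Definition _ := gen_choiceMixin adm.

Definition adm_dist x y : R := lim (gdist N (x n) (y n) / s n @[n --> U]).

Lemma adm_dist_cvg x y : cvg (gdist N (x n) (y n) / s n @[n --> U]).
Proof.
have [C xC] := adm_bounded x; have [D yD] := adm_bounded y.
apply: (@ultra_cvg_bounded _ _ _ UU _ 0 (C + D)) => n; apply/andP; split.
  by rewrite divr_ge0 ?gdist_ge0// ltW.
apply: le_trans (lerD (xC n) (yD n)).
by rewrite -mulrDl ler_pM2r ?invr_gt0// gdist_le.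
Qed.

Lemma adm_distxx x : adm_dist x x = 0.
Proof.
rewrite /adm_dist; under eq_fun do rewrite gdistxx mul0r.
exact: lim_cst.
Qed.

Lemma adm_distC x y : adm_dist x y = adm_dist y x.
Proof. by rewrite /adm_dist; under eq_fun do rewrite gdistC. Qed.

Lemma adm_dist_triangle y x z : adm_dist x z <= adm_dist x y + adm_dist y z.
Proof.
have [cxy cyz] := (@adm_dist_cvg x y, @adm_dist_cvg y z).
rewrite /adm_dist -limD//; apply: ler_lim; first exact: adm_dist_cvg.
  exact: is_cvgD.
apply: nearW => n /=.
by rewrite -mulrDl ler_pM2r ?invr_gt0// gdist_triangle.
Qed.

Lemma adm_dist_ge0 x y : 0 <= adm_dist x y.
Proof.
apply: limr_ge; first exact: adm_dist_cvg.
by apply: nearW => n; rewrite divr_ge0 ?gdist_ge0// ltW.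
Qed.

Definition adm_eq : rel adm := fun x y => adm_dist x y == 0.

Fact adm_eq_refl : reflexive adm_eq.
Proof. by move=> x; rewrite /adm_eq adm_distxx. Qed.

Fact adm_eq_sym : symmetric adm_eq.
Proof. by move=> x y; rewrite /adm_eq adm_distC. Qed.

Fact adm_eq_trans : transitive adm_eq.
Proof.
move=> y x z /eqP xy /eqP yz; rewrite /adm_eq eq_le adm_dist_ge0 andbT.
by rewrite (le_trans (adm_dist_triangle y x z))// xy yz addr0.
Qed.

Canonical adm_equiv := EquivRel adm_eq adm_eq_refl adm_eq_sym adm_eq_trans.

Definition asymptotic_cone := {eq_quot adm_equiv}.

HB.instance Definition _ := Choice.on asymptotic_cone.
HB.instance Definition _ := EqQuotient.on asymptotic_cone.

Definition cone_dist (a b : asymptotic_cone) : R := adm_dist (repr a) (repr b).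

Lemma cone_distE x y :
  cone_dist (\pi_asymptotic_cone x) (\pi_asymptotic_cone y) = adm_dist x y.
Proof.
have rK z : adm_dist (repr (\pi_asymptotic_cone z)) z = 0.
  by apply/eqP; apply/(eqmodP adm_equiv); rewrite reprK.
rewrite /cone_dist; apply/eqP; rewrite eq_le; apply/andP; split.
- apply: le_trans (adm_dist_triangle x _ _) _; rewrite rK add0r.
  apply: le_trans (adm_dist_triangle y _ _) _.
  by rewrite (adm_distC y) rK addr0.
- apply: le_trans (adm_dist_triangle (repr (\pi_asymptotic_cone x)) _ _) _.
  rewrite adm_distC rK add0r.
  apply: le_trans (adm_dist_triangle (repr (\pi_asymptotic_cone y)) _ _) _.
  by rewrite rK addr0.
Qed.

Fact cone_distxx a : cone_dist a a = 0.
Proof. exact: adm_distxx. Qed.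

Fact cone_dist_eq0 a b : cone_dist a b = 0 -> a = b.
Proof.
move=> /eqP ab; rewrite -[a]reprK -[b]reprK.
exact/(eqmodP adm_equiv).
Qed.

Fact cone_distC a b : cone_dist a b = cone_dist b a.
Proof. exact: adm_distC. Qed.

Fact cone_dist_triangle b a c : cone_dist a c <= cone_dist a b + cone_dist b c.
Proof. exact: adm_dist_triangle. Qed.

HB.instance Definition _ := isMetric.Build R asymptotic_cone
  cone_distxx cone_dist_eq0 cone_distC cone_dist_triangle.

End asymptotic_cone.

Arguments asymptotic_cone {R G} N {U} UU {s} s_gt0.

(* H takes values on all of R * X, but only its restriction to [0, 1] x X is
   required to be continuous (for the product topology). *)
Definition homotopic (R : realType) (X Y : topologicalType) (f g : X -> Y) :=
  exists H : R * X -> Y,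
    [/\ {within `[0, 1]%classic `*` [set: X], continuous H},
        forall x, H (0, x) = f x & forall x, H (1, x) = g x].

Definition contractible (R : realType) (X : topologicalType) :=
  exists x0 : X, homotopic R (@idfun X) (cst x0).

(* Main.v *)
(* Moving only the first non-trivial coordinate by the corresponding p_i gives
   a single map p on the direct sum with the same properties as the p_i: it is
   1-Lipschitz (if the first non-trivial indices of x and y differ, the gain
   of 1 at the smaller one pays for the move of 1 at the other one), it moves
   points by at most 1, and it shortens non-trivial elements by at least 1.
   For such a p the homotopy H(t, [x_n]) = [p^k(x_n)] with
   k = floor (t * |x_n|) contracts the cone: it is the identity at t = 0,
   constant at t = 1, and
   d(p^k(x), p^l(y)) <= d(x, y) + |k - l|
                     <= d(x, y) + |t - u| |x| + |u| d(x, y) + 1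
   for k = floor (t |x|) and l = floor (u |y|), where the last summand
   disappears after rescaling. *)
Require Import Defs.
From mathcomp Require Import all_boot all_order all_algebra.
From mathcomp Require Import all_classical all_reals all_analysis.
From mathcomp Require Import lra.

Import Order.TTheory GRing.Theory Num.Theory.
Import numFieldNormedType.Exports.

Local Open Scope classical_set_scope.
Local Open Scope ring_scope.

Lemma ler_dist_truncn (R : archiRealDomainType) (a b : R) :
  `|(Num.truncn a)%:R - (Num.truncn b)%:R| <= `|a - b| + 1 :> R.
Proof.
wlog ba : a b / b <= a => [h|].
  by have [/h//|/ltW/h] := leP b a; rewrite distrC (distrC b).
have tba : (Num.truncn b)%:R <= (Num.truncn a)%:R :> R.
  by rewrite ler_nat le_truncn.
rewrite ger0_norm ?subr_ge0// ger0_norm ?subr_ge0//.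
(* [Num.truncn] is 0, not the floor, on negative numbers. *)
have [a0|a0] := leP 0 a; last first.
  rewrite (_ : Num.truncn a = 0%N); last by apply/eqP; rewrite -leqn0 truncn_le_nat; lra.
  by have := ler0n R (Num.truncn b); lra.
have : (Num.truncn a)%:R <= a by rewrite truncn_le.
have := truncnS_gt b; rewrite -natr1.
by lra.
Qed.

(** * Iterating a 1-Lipschitz, norm-decreasing self-map of a normed group *)

Section contraction.
Context (R : realType) (G : groupType) (N : group_norm R G) (p : G -> G).
Hypothesis p_lip : forall g h, gdist N (p g) (p h) <= gdist N g h.
Hypothesis p_near : forall g, gdist N (p g) g <= 1.
Hypothesis p1 : p 1%g = 1%g.
Hypothesis p_drop : forall g, g <> 1%g -> N (p g) + 1 <= N g.

Lemma iter_lip k g h : gdist N (iter k p g) (iter k p h) <= gdist N g h.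
Proof. by elim: k => //= k; exact: le_trans. Qed.

Lemma iter_near k g : gdist N (iter k p g) g <= k%:R.
Proof.
elim: k => [|k IH]; first by rewrite gdistxx.
rewrite iterS (le_trans (gdist_triangle N (iter k p g) _ _))//.
by rewrite -natr1 addrC lerD.
Qed.

(** For [l <= k], write [p^k g = p^l (p^(k-l) g)]; as [p^l] is 1-Lipschitz, only the [k - l] extra
    moves count. *)
Lemma iter_dist k l g :
  gdist N (iter k p g) (iter l p g) <= `|k%:R - l%:R|.
Proof.
wlog lk : k l / (l <= k)%N => [h|].
  by have [/h//|/ltnW/h] := leqP l k; rewrite gdistC distrC.
rewrite -natrB// ger0_norm//.
rewrite -[in leLHS](subnKC lk) iterD (le_trans (iter_lip _ _ _))//.
exact: iter_near.
Qed.

Lemma iter_drop k g : N (iter k p g) + k%:R <= N g \/ iter k p g = 1%g.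
Proof.
elim: k => [|k IH]; first by left; rewrite addr0.
rewrite iterS; have [->|/eqP e] := eqVneq (iter k p g) 1%g; first by right.
by left; case: IH => // IH; have := p_drop _ e; rewrite -natr1; lra.
Qed.

Lemma iter1 k : iter k p 1%g = 1%g.
Proof. by elim: k => //= k ->. Qed.

Lemma gdistg1 g : gdist N g 1%g = N g.
Proof. by rewrite /gdist invg1 mulg1. Qed.

Lemma iter_norm_le k g : N (iter k p g) <= N g.
Proof. by rewrite -gdistg1 -(iter1 k) (le_trans (iter_lip _ _ _))// gdistg1. Qed.

Lemma iter_truncn_norm g : iter (Num.truncn (N g)) p g = 1%g.
Proof.
set k := Num.truncn _; case: (iter_drop k g) => // h.
(* If [p^k g] were non-trivial, one more step would push the norm down to [N g - k - 1], which is
   negative. *)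
have [//|/eqP/p_drop e] := eqVneq (iter k p g) 1%g.
exfalso; move: e.
have := gnorm_ge0 N (p (iter k p g)).
have := truncnS_gt (N g); rewrite -natr1 -/k; lra.
Qed.

Lemma gdist_scaled_iter t u g h :
  gdist N (iter (Num.truncn (t * N g)) p g) (iter (Num.truncn (u * N h)) p h)
  <= (1 + `|u|) * gdist N g h + `|t - u| * N g + 1.
Proof.
set k := Num.truncn _; set l := Num.truncn _.
have kl : gdist N (iter k p g) (iter l p h) <= gdist N g h + `|k%:R - l%:R|.
  rewrite (le_trans (gdist_triangle N (iter k p h) _ _))//.
  by rewrite lerD ?iter_lip ?iter_dist.
have Ngh : `|N g - N h| <= gdist N g h.
  have := gdist_triangle N h g 1%g; have := gdist_triangle N g h 1%g.
  by rewrite !gdistg1 (gdistC N h g) ler_norml; lra.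
have : `|t * N g - u * N h| <= `|t - u| * N g + `|u| * gdist N g h.
  rewrite (_ : _ - _ = (t - u) * N g + u * (N g - N h)); last by lra.
  rewrite (le_trans (ler_normD _ _))// !normrM (ger0_norm (gnorm_ge0 N g)).
  by rewrite lerD2l ler_wpM2l.
have := ler_dist_truncn R (t * N g) (u * N h); rewrite -/k -/l.
by lra.
Qed.

(** * Passage to the asymptotic cone *)

Context (U : set_system nat) (UU : UltraFilter U).
Context (s : nat -> R) (s_gt0 : forall n, 0 < s n).
Hypothesis s_oo : s n @[n --> U] --> +oo.

(** Since [p] fixes 1 and is 1-Lipschitz, iterating never increases the norm, so a bound for [x]
    serves for every real [t]. *)
Lemma scaled_iter_bounded (t : R) (x : admissible N s) :
  exists C : R, forall n, N (iter (Num.truncn (t * N (x n))) p (x n)) / s n <= C.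
Proof.
have [C xC] := adm_bounded x; exists C => n; apply: le_trans (xC n).
by rewrite ler_pM2r ?invr_gt0// iter_norm_le.
Qed.

Definition scaled_iter t x : admissible N s := Admissible (scaled_iter_bounded t x).

Lemma adm_dist_scaled_iter t u (x y : admissible N s) (C : R) :
  (forall n, N (x n) / s n <= C) ->
  adm_dist U (scaled_iter t x) (scaled_iter u y)
  <= (1 + `|u|) * adm_dist U x y + `|t - u| * C.
Proof.
move=> xC.
have sV : (s n)^-1 @[n --> U] --> (0 : R).
  by apply/gtr0_cvgV0 => //; exact: nearW.
have cxy := @adm_dist_cvg R G N U UU s s_gt0 x y.
(* Dividing [gdist_scaled_iter] by [s n] turns its last summand 1 into [1 / s n], which tends to
   0. *)
pose b n := (1 + `|u|) * (gdist N (x n) (y n) / s n) + `|t - u| * C + (s n)^-1.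
have cb : b n @[n --> U] --> (1 + `|u|) * adm_dist U x y + `|t - u| * C + 0.
  apply: cvgD => //; apply: cvgD; last exact: cvg_cst.
  exact: cvgMr.
rewrite -[leRHS]addr0 -(cvg_lim _ cb)//.
apply: ler_lim; [exact: adm_dist_cvg|by apply/cvg_ex; eexists; exact: cb|].
apply: nearW => n; rewrite /b /=.
have sn0 : 0 <= (s n)^-1 by rewrite invr_ge0 ltW.
have := ler_wpM2r sn0 (gdist_scaled_iter t u (x n) (y n)).
have := ler_wpM2l (normr_ge0 (t - u)) (xC n).
by rewrite !mulrDl !mul1r !mulrA; lra.
Qed.

Lemma adm_dist_eq (x y : admissible N s) :
  (forall n, x n = y n) -> adm_dist U x y = 0.
Proof.
move=> xy; rewrite /adm_dist; under eq_fun do rewrite xy gdistxx mul0r.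
exact: lim_cst.
Qed.

Let cone := asymptotic_cone N UU s_gt0.

(** Defined on chosen representatives; by [adm_dist_scaled_iter] with [t = u], another choice gives
    the same class. *)
Definition cone_contraction (tx : R * cone) : cone :=
  (\pi_(asymptotic_cone N UU s_gt0) (scaled_iter tx.1 (repr tx.2)))%qT.

Lemma cone_contraction_continuous : continuous cone_contraction.
Proof.
move=> [t a]; have [C xC] := adm_bounded (repr a).
have C0 : 0 <= C by rewrite (le_trans _ (xC 0%N))// divr_ge0 ?gnorm_ge0// ltW.
apply/cvg_ballP => e e0.
(* As [d <= 1] forces [|u| <= |t| + 1], the bound [(1 + |u|) d + d C] is at most [d K], hence at
   most [e]. *)
pose K := 2 + `|t| + C; have K0 : 0 < K by rewrite /K; have := normr_ge0 t; lra.
pose d := Num.min 1 (e / K).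
have d0 : 0 < d by rewrite lt_min ltr01 divr_gt0.
exists (ball t d, ball a d); first by split; exact: nbhsx_ballx.
move=> [u b] [tu ab].
have {}tu : `|t - u| < d by exact: tu.
have {}ab : adm_dist U (repr a) (repr b) < d by exact: ab.
change (cone_dist (cone_contraction (t, a)) (cone_contraction (u, b)) < e).
rewrite cone_distE/=.
apply: le_lt_trans (adm_dist_scaled_iter t u (repr a) (repr b) C xC) _.
have [d1 dK] : d <= 1 /\ d * K <= e.
  rewrite -ler_pdivlMr//; split; rewrite /d ge_min lexx ?orbT//.
have ut : `|u| <= `|t| + 1.
  have := ler_normB t (t - u); rewrite subKr; lra.
have D0 := adm_dist_ge0 UU s_gt0 (repr a) (repr b).
apply: lt_le_trans dK.
have : (1 + `|u|) * adm_dist U (repr a) (repr b) < (2 + `|t|) * d.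
  have u0 := normr_ge0 u; have t0 := normr_ge0 t; nra.
have : `|t - u| * C <= d * C by rewrite ler_wpM2r// ltW.
rewrite /K; lra.
Qed.

Lemma asymptotic_cone_contractible : contractible R cone.
Proof.
have adm1 : exists C : R, forall n, N ((fun=> 1%g) n : G) / s n <= C.
  by exists 0 => n; rewrite gnorm1 mul0r.
pose o : admissible N s := Admissible adm1.
exists (\pi_(asymptotic_cone N UU s_gt0) o)%qT, cone_contraction; split.
- by apply: continuous_subspaceT; exact: cone_contraction_continuous.
- move=> x; rewrite -[RHS]reprK; apply: cone_dist_eq0; rewrite cone_distE.
  by apply: adm_dist_eq => n /=; rewrite mul0r truncn0.
- move=> x; apply: cone_dist_eq0; rewrite cone_distE.
  by apply: adm_dist_eq => n /=; rewrite mul1r iter_truncn_norm.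
Qed.

End contraction.

(** * Moving the first non-trivial coordinate in a direct sum *)

Section dsum_contraction.
Context (R : realType) (disp : Order.disp_t) (I : orderType disp).
Context (G : I -> groupType) (N : forall i, group_norm R (G i)).
Context (p : forall i, G i -> G i).
Hypothesis p_lip : forall i (g h : G i),
  gdist (N i) (p i g) (p i h) <= gdist (N i) g h.
Hypothesis p_near : forall i (g : G i), gdist (N i) (p i g) g <= 1.
Hypothesis p1 : forall i, p i 1%g = 1%g.
Hypothesis p_drop : forall i (g : G i), g <> 1%g -> N i (p i g) + 1 <= N i g.
Implicit Types (x y : dsum G) (i j : I).

Definition is_first x i := x i <> 1%g /\ forall j, (j < i)%O -> x j = 1%g.

Lemma is_first_inj x i j : is_first x i -> is_first x j -> i = j.
Proof.
move=> [xi ix] [xj jx]; apply/eqP; rewrite eq_le !leNgt.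
by apply/andP; split; apply/negP => lt; [apply: xj; exact: ix|apply: xi; exact: jx].
Qed.

(** The order on [I] need not be well-founded; the minimum exists because the support is finite. *)
Lemma ex_is_first x : x <> 1%g -> exists i, is_first x i.
Proof.
move=> x1; have [i xi] : exists i, x i != 1%g.
  apply: contrapT => h; apply: x1; apply: dsum_ext => i /=.
  by apply/eqP; apply/negPn/negP => xi; apply: h; exists i.
have /finite_seqP[r xr] := dsum_finite x.
have rP j : (j \in r) = (x j != 1%g).
  apply/idP/idP; first by rewrite -[X in X -> _]/([set` r] j) -xr.
  by rewrite -[X in X -> _]/([set k | x k != 1%g] j) xr.
have [m mr mP] : exists2 m, m \in r & forall j, j \in r -> (m <= j)%O.
  have : i \in r by rewrite rP.
  elim: r {xr rP} i {xi} => // a r IH i _.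
  have [->|] := eqVneq r [::].
    by exists a => [|j]; rewrite inE// => /eqP ->.
  case: r IH => // b r /(_ b) []; first by rewrite inE eqxx.
  move=> m mr mP _; have [am|ma] := leP a m.
    exists a => [|j]; first by rewrite inE eqxx.
    by rewrite inE => /predU1P[->//|/mP]; exact: le_trans.
  exists m => [|j]; first by rewrite inE mr orbT.
  by rewrite inE => /predU1P[->|/mP//]; exact: ltW.
exists m; split; first by apply/eqP; rewrite -rP.
by move=> j jm; apply/eqP; apply: contraLR jm; rewrite -rP -leNgt; exact: mP.
Qed.

(** Testing each [i] separately lets [p i] act on [x i] without transport between the types
    [G i]. *)
Definition shrink_first_val x i : G i :=
  if `[< is_first x i >] then p i (x i) else x i.

Lemma shrink_first_finite x : finite_set [set i | shrink_first_val x i != 1%g].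
Proof.
apply: sub_finite_set (dsum_finite x) => i /=; apply: contra_neq.
by rewrite /shrink_first_val => ->; case: ifP => // _; exact: p1.
Qed.

Definition shrink_first x : dsum G := DSum (shrink_first_finite x).

Lemma shrink_first_at x i : is_first x i -> shrink_first x i = p i (x i).
Proof. by move=> xi; rewrite /= /shrink_first_val asboolT. Qed.

Lemma shrink_first_off x i j : is_first x i -> j <> i -> shrink_first x j = x j.
Proof.
move=> xi ji; rewrite /= /shrink_first_val asboolF// => xj.
exact: ji (is_first_inj _ _ _ xj xi).
Qed.

Lemma shrink_first1 : shrink_first 1%g = 1%g.
Proof. by apply: dsum_ext => i; rewrite /= /shrink_first_val p1 if_same. Qed.

Lemma l1_le x y : (forall i, N i (x i) <= N i (y i)) -> l1 N x <= l1 N y.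
Proof.
move=> xy; have Uf : finite_set ([set i | x i != 1%g] `|` [set i | y i != 1%g]).
  by rewrite finite_setU; split; exact: dsum_finite.
rewrite (l1E N Uf (x := x)); last by move=> i; left.
rewrite (l1E N Uf (x := y)); last by move=> i; right.
by rewrite !fsbig_finite//=; exact: ler_sum.
Qed.

Lemma l1_change_one x y i (c : R) : (forall j, j <> i -> x j = y j) ->
  N i (x i) + c <= N i (y i) -> l1 N x + c <= l1 N y.
Proof.
move=> xy xyi.
(* [i] is added because both [x i] and [y i] may be trivial, and its term is split off below. *)
pose A := [set j | x j != 1%g] `|` [set j | y j != 1%g] `|` [set i].
have Af : finite_set A.
  by rewrite !finite_setU; split=> //; split; exact: dsum_finite.
have Ai : A i by right.
rewrite (l1E N Af (x := x)); last by move=> j; left; left.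
rewrite (l1E N Af (x := y)); last by move=> j; left; right.
rewrite !(fsbigD1 i A)//= -addrA (addrC _ c) addrA lerD//.
rewrite le_eqVlt; apply/orP; left; apply/eqP; apply: eq_fsbigr => j.
by rewrite inE => -[_ /= ji]; rewrite xy.
Qed.

Lemma dsum_divE x y i : (x * y^-1)%g i = (x i * (y i)^-1)%g.
Proof. by []. Qed.

Lemma shrink_first_near x : gdist (l1_norm N) (shrink_first x) x <= 1.
Proof.
have [->|/eqP/ex_is_first[i xi]] := eqVneq x 1%g.
  by rewrite shrink_first1 gdistxx.
(* The quotient of the two elements is compared with 1 by [l1_change_one] with [c = -1]. *)
rewrite -subr_le0 -(gnorm1 (l1_norm N)).
apply: (l1_change_one _ _ i) => [j ji|].
  by rewrite dsum_divE (shrink_first_off _ _ _ xi ji) mulgV.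
rewrite dsum_divE shrink_first_at// gnorm1.
by have := p_near i (x i); rewrite /gdist; lra.
Qed.

(** At [i] the distance to [y] is just the norm of [x i], which [p i] lowers by at least 1. *)
Lemma shrink_first_toward x y i : is_first x i -> y i = 1%g ->
  gdist (l1_norm N) (shrink_first x) y + 1 <= gdist (l1_norm N) x y.
Proof.
move=> xi yi; apply: (l1_change_one _ _ i) => [j ji|].
  by rewrite dsum_divE (shrink_first_off _ _ _ xi ji).
rewrite dsum_divE shrink_first_at//= yi invg1 !mulg1.
by case: xi => xi _; exact: p_drop.
Qed.

Lemma shrink_first_drop x : x <> 1%g ->
  l1_norm N (shrink_first x) + 1 <= l1_norm N x.
Proof.
move=> /ex_is_first[i xi].
by have := shrink_first_toward x 1%g i xi erefl; rewrite !gdistg1.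
Qed.

Lemma shrink_first_lip x y :
  gdist (l1_norm N) (shrink_first x) (shrink_first y) <= gdist (l1_norm N) x y.
Proof.
(* The gain of 1 from moving [x'] pays for moving [y']. This covers a trivial element and distinct
   first indices, where the element with the larger one is trivial at the smaller. *)
have key x' y' i : is_first x' i -> y' i = 1%g ->
    gdist (l1_norm N) (shrink_first x') (shrink_first y')
    <= gdist (l1_norm N) x' y'.
  move=> xi yi; have := shrink_first_toward x' y' i xi yi.
  have := shrink_first_near y'; rewrite gdistC.
  by have := gdist_triangle (l1_norm N) y' (shrink_first x') (shrink_first y'); lra.
have [->|/eqP/ex_is_first[i xi]] := eqVneq x 1%g.
  have [->|/eqP/ex_is_first[j yj]] := eqVneq y 1%g; first by rewrite shrink_first1.
  by rewrite gdistC (gdistC _ 1%g); exact: (key _ _ j).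
have [->|/eqP/ex_is_first[j yj]] := eqVneq y 1%g; first exact: (key _ _ i).
have [ij|ji|ij] := ltgtP i j.
- by apply: (key _ _ i) => //; case: yj => _; exact.
- by rewrite gdistC (gdistC _ x); apply: (key _ _ j) => //; case: xi => _; exact.
(* With a common first index the estimate holds coordinatewise. *)
subst j; apply: l1_le => k.
have [->|/eqP ki] := eqVneq k i.
  rewrite dsum_divE.
  by rewrite !shrink_first_at//; exact: p_lip.
rewrite dsum_divE.
by rewrite (shrink_first_off _ _ _ xi ki) (shrink_first_off _ _ _ yj ki).
Qed.

End dsum_contraction.

Theorem proposition4p5 (R : realType) (disp : Order.disp_t)
    (I : orderType disp) (G : I -> groupType)
    (N : forall i : I, group_norm R (G i)) (p : forall i : I, G i -> G i)
    (N_int : forall (i : I) (g : G i), N i g \is a Num.int)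
    (p_lip : forall (i : I) (g h : G i),
       gdist (N i) (p i g) (p i h) <= gdist (N i) g h)
    (p_near : forall (i : I) (g : G i), gdist (N i) (p i g) g <= 1)
    (p_lt : forall (i : I) (g : G i), g <> 1%g -> N i (p i g) < N i g)
    (p1 : forall i : I, p i 1%g = 1%g)
    (U : set_system nat) (UU : UltraFilter U)
    (U_nonprincipal : forall n : nat, U <> principal_filter n)
    (s : nat -> R) (s_gt0 : forall n : nat, 0 < s n)
    (s_oo : s n @[n --> U] --> +oo) :
  contractible R (asymptotic_cone (l1_norm N) UU s_gt0).
Proof.
(* Between integers a strict inequality leaves a gap of at least 1. *)
have p_drop i (g : G i) : g <> 1%g -> N i (p i g) + 1 <= N i g.
  move=> /p_lt; have /intrP[a ->] := N_int i g.
  have /intrP[b ->] := N_int i (p i g).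
  by rewrite ltr_int -[1]/(1%:~R) -intrD ler_int lezD1.
apply: (@asymptotic_cone_contractible R _ (l1_norm N)
  (shrink_first disp I G p p1)) => //.
- exact: shrink_first_lip.
- exact: shrink_first_near.
- exact: shrink_first1.
- exact: shrink_first_drop.
Qed.
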